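(* Let $X$ be a finite-dimensional real Hilbert space and let $f:X\to\left]-\infty,+\infty\right]$ and $g:X\to\left]-\infty,+\infty\right]$ be proper lower semicontinuous convex functions. Let $T_{(\partial f,\partial g)}$ be the Douglas--Rachford operator of $(\partial f,\partial g)$. Then: (i) $\operatorname{ran}(\mathrm{Id}-T_{(\partial f,\partial g)})\simeq(\operatorname{dom}f-\operatorname{dom}g)\cap(\operatorname{dom}f^*+\operatorname{dom}g^* )$. (ii) $\operatorname{ran}T_{(\partial f,\partial g)}\simeq(\operatorname{dom}f-\operatorname{dom}g^* )\cap(\operatorname{dom}f^*+\operatorname{dom}g)$.
   Context: $\partial f$ is the convex subdifferential, $f^*$ the Fenchel conjugate, and $\operatorname{dom}f=\{x: f(x)<+\infty\}$. For a maximally monotone operator $A$ on $X$, the resolvent is $J_A=(\mathrm{Id}+A)^{-1}$ and the reflected resolvent is $R_A=2J_A-\mathrm{Id}$. The Douglas--Rachford operator of the ordered pair $(A,B)$ of maximally monotone operators is $T_{(A,B)}:=\tfrac12\mathrm{Id}+\tfrac12R_BR_A=\mathrm{Id}-J_A+J_BR_A$. For $S\subseteq X$, $\operatorname{ri}S$ is the interior of $S$ relative to its affine hull. Near equality: $C\simeq D$ means $\overline{C}=\overline{D}$ and $\operatorname{ri}C=\operatorname{ri}D$. Sums and differences of sets are Minkowski sums and differences. *)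

(* Defs.v *)
From HB Require Import structures.
From mathcomp Require Import all_boot all_order all_algebra.
From mathcomp Require Import all_classical all_reals all_analysis.

Set Implicit Arguments.
Unset Strict Implicit.
Unset Printing Implicit Defensive.

Import Order.TTheory GRing.Theory Num.Theory.
Import numFieldNormedType.Exports.

Local Open Scope classical_set_scope.
Local Open Scope ring_scope.

(* The norm (hence the topology) of [X] is the one induced by the inner
   product.  Finite dimension comes from [Vector] and implies completeness. *)
HB.mixin Record NormedModule_hasInner (R : realType) X
    of NormedModule R X := {
  inner : {dot X for (@idfun R)} ;
  inner_norm : forall x : X, inner x x = `|x| ^+ 2
}.

#[short(type="finHilbertType")]
HB.structure Definition FinHilbert (R : realType) :=
  { X of NormedModule R X & Vector R X & NormedModule_hasInner R X }.

Notation "''<' x , y >" := (inner x y)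
  (at level 8, x at level 49, y at level 49, format "''<' x ,  y >") : ring_scope.

Section MinkowskiSets.
Context {R : realType} {X : normedModType R}.
Implicit Types C D S : set X.

Definition set_add C D : set X := [set c + d | c in C & d in D].
Definition set_sub C D : set X := [set c - d | c in C & d in D].

Definition affine_set S : Prop :=
  forall x y (t : R), S x -> S y -> S (t *: x + (1 - t) *: y).

Definition affine_hull S : set X := smallest affine_set S.

Definition rel_interior S : set X :=
  [set x | affine_hull S x /\ within (affine_hull S) (nbhs x) S].

Definition near_equal C D : Prop :=
  closure C = closure D /\ rel_interior C = rel_interior D.

End MinkowskiSets.

Notation "C ≃ D" := (near_equal C D)
  (at level 70, no associativity) : classical_set_scope.

(* Set-valued operators [A : X ⇉ X] are functions [X -> set X]; the resolvent
   is the set-valued inverse of [Id + A], which is single-valued with full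
   domain when [A] is maximally monotone. *)
Section SetValuedOperators.
Context {R : realType} {X : normedModType R}.
Implicit Types A B : X -> set X.

Definition op_id : X -> set X := fun x => [set x].
Definition op_add A B : X -> set X := fun x => set_add (A x) (B x).
Definition op_sub A B : X -> set X := fun x => set_sub (A x) (B x).
Definition op_scale (c : R) A : X -> set X := fun x => [set c *: u | u in A x].
Definition op_comp B A : X -> set X := fun x => \bigcup_(y in A x) B y.
Definition op_inv A : X -> set X := fun u => [set x | A x u].
Definition op_range A : set X := \bigcup_x A x.

Definition resolvent A : X -> set X := op_inv (op_add op_id A).

Definition reflected_resolvent A : X -> set X :=
  op_sub (op_scale 2 (resolvent A)) op_id.

Definition douglas_rachford A B : X -> set X :=
  op_add (op_scale 2^-1 op_id)
    (op_scale 2^-1 (op_comp (reflected_resolvent B) (reflected_resolvent A))).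

End SetValuedOperators.

Section ConvexFunctions.
Context {R : realType} {X : finHilbertType R}.
Implicit Types f : X -> \bar R.
Local Open Scope ereal_scope.

Definition edom f : set X := [set x | f x < +oo].

Definition eproper f : Prop := (forall x, -oo < f x) /\ edom f !=set0.

(* The library's [convex_function] is only for real-valued functions. *)
Definition econvex f : Prop :=
  forall (x y : X) (t : R), (0 < t < 1)%R ->
    f (t *: x + (1 - t) *: y)%R <= t%:E * f x + (1 - t)%:E * f y.

Definition subdifferential f : X -> set X :=
  fun x => [set u | forall y, f x + ('<(y - x)%R, u>)%:E <= f y].

Definition fenchel_conjugate f : X -> \bar R :=
  fun u => ereal_sup [set ('<x, u>)%:E - f x | x in setT].

End ConvexFunctions.

(* Main.v *)
Require Import Defs.
From mathcomp Require Import all_boot all_order all_algebra.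
From mathcomp Require Import all_classical all_reals all_analysis.
From mathcomp Require Import ring lra.

(** Write [M] for [Id - T].  For each [x] put [a = J_A x], [u = x - a],
[b = J_B (a - u)] and [v = a - u - b], where [A] and [B] are the
subdifferentials of [f] and [g].  Then [u] is in [A a], [v] is in [B b],
[M x = a - b = u + v] and [T x = u + b = a - v].  In particular the range of [M]
lies in [D = (dom f - dom g) `&` (dom f^* + dom g^* )], and it remains to see
that it is dense in [D] and contains the relative interior of [D].

This is a Brezis-Haraux argument.  First, [M] is firmly nonexpansive, hence
continuous, and [e *: x + M x = w] has a solution for every [w] and every
[e > 0] ([regularized_surj]).  Second, for every
[z = p - q = p' + q'] in [D] the numbers [<M x - z, x>] are bounded below over
all [x]; this follows by applying the Fenchel-Young inequality to [f] at
[(a, p')] and [(p, u)], and to [g] at [(b, q')] and [(q, v)]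
([rectangular_displacement_range]).  For the solutions [x] of the regularized
equation, the lower bound reads [<z - w, x> + e * |x| ^+ 2 <= C_z].  If [w] is in
[D], taking [z = w] shows [e *: x -> 0], so that [M x -> w].  If [w] is a relative
interior point of [D], varying [z] around [w] bounds [x] in all directions of the
affine hull of [D], which are the only ones that [x] can take because
[e *: x = w - M x]; a cluster point of the solutions as [e -> 0] is then a preimage
of [w] ([rel_interior_sub_range]).

The description of [x], [M x] and [T x] by [(a, b, v)] is symmetric under the
exchange of [b] with [v], of [B] with its inverse, and of [M] with [T].  The
statement on the range of [T] is therefore the same one for the pair formed by
[A] and the inverse of [B] ([rectangular_inv]).

Convexity and lower semicontinuity serve to define the resolvents everywhere
([prox_exists]): a lower bound on the unit ball around a point of the domain
gives [f] an at most linear decay, so that [f + |. - x| ^+ 2 / 2] has a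
minimizer. *)

Set Implicit Arguments.
Unset Strict Implicit.
Unset Printing Implicit Defensive.

Import Order.TTheory GRing.Theory Num.Theory.
Import numFieldNormedType.Exports.

Local Open Scope classical_set_scope.
Local Open Scope ring_scope.

(** * Inner product *)

Section InnerProduct.
Context {R : realType} {X : finHilbertType R}.
Implicit Types x y z : X.

Lemma innerC x y : '<x, y> = '<y, x>.
Proof. by rewrite hermC expr0 mul1r. Qed.
Lemma innerDl x y z : '<(x + y), z> = '<x, z> + '<y, z>.
Proof. exact: linearDl. Qed.
Lemma innerDr x y z : '<z, (x + y)> = '<z, x> + '<z, y>.
Proof. exact: linearDr. Qed.
Lemma innerNl x y : '<(- x), y> = - '<x, y>.
Proof. exact: linearNl. Qed.
Lemma innerNr x y : '<y, (- x)> = - '<y, x>.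
Proof. exact: linearNr. Qed.
Lemma innerZl c x y : '<(c *: x), y> = c * '<x, y>.
Proof. exact: linearZl_LR. Qed.
Lemma innerZr c x y : '<y, (c *: x)> = c * '<y, x>.
Proof. by rewrite innerC innerZl innerC. Qed.
Definition innerE := (innerDl, innerDr, innerNl, innerNr, innerZl, innerZr).

Lemma inner_sqr_ge0 x : 0 <= '<x, x>.
Proof. by rewrite inner_norm sqr_ge0. Qed.

Lemma ler_norm_inner x y : '<x, x> <= '<y, y> -> `|x| <= `|y|.
Proof. by rewrite !inner_norm ler_pXn2r// nnegrE. Qed.

(** For [x] and [y] the increments of a map and of its complement to the
identity, this says that firm nonexpansiveness makes the map 1-Lipschitz. *)
Lemma ler_normD_inner_ge0 x y : 0 <= '<x, y> -> `|x| <= `|x + y|.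
Proof.
move=> xy; apply: ler_norm_inner; have := inner_sqr_ge0 y.
by rewrite !innerE (innerC y x); lra.
Qed.

End InnerProduct.

(** * Topology of finite-dimensional spaces *)

Lemma lipschitz_continuous {R : realType} {V W : normedModType R}
    (k : R) (h : V -> W) :
  (forall x y, `|h x - h y| <= k * `|x - y|) -> continuous h.
Proof.
move=> hk x; apply/cvgrPdist_lt => e e0.
have k0 : 0 < `|k| + 1 by rewrite ltr_wpDl.
near=> y.
apply: le_lt_trans (hk _ _) _.
apply: (@le_lt_trans _ _ ((`|k| + 1) * `|x - y|)).
  by apply: ler_wpM2r => //; rewrite (le_trans (ler_norm _))// lerDl.
rewrite mulrC -ltr_pdivlMr//.
near: y; apply: (@cvgr_dist_lt _ _ _ (nbhs x) _ id x); first exact: cvg_id.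
by rewrite divr_gt0.
Unshelve. all: by end_near. Qed.

Lemma norm_normalize {R : realType} {V : normedModType R} (v : V) :
  v != 0 -> `|(`|v|^-1 *: v)| = 1.
Proof. by move=> v0; rewrite normrZ normfV normr_id mulVf// normr_eq0. Qed.

Import passmx.

Section FiniteDimension.
Context {R : realType} {X : finHilbertType R}.
Implicit Types x y z : X.

Lemma mx_entry_le_norm m (v : 'rV[R]_m) i : `|v 0 i| <= `|v|.
Proof.
rewrite [leRHS]/Num.norm /= mx_normrE; apply/bigmax_geP; right => /=.
by exists (0, i).
Qed.

Lemma rV_linear_lipschitz m (h : {linear 'rV[R]_m -> X}) :
  exists k : R, forall v, `|h v| <= k * `|v|.
Proof.
exists (\sum_i `|h (delta_mx 0 i)|) => v.
rewrite {1}(row_sum_delta v) linear_sum mulr_suml.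
apply: le_trans (ler_norm_sum _ _ _) _; apply: ler_sum => i _.
by rewrite linearZ /= normrZ mulrC ler_wpM2l// mx_entry_le_norm.
Qed.

Let e := vbasis {:X}.
Let n := \dim {:X}.
Let e_basis : basis_of {:X} e := vbasisP _.

Lemma vecof_continuous : continuous (vecof e).
Proof.
have [k hk] := rV_linear_lipschitz (vecof e : {linear 'rV[R]_n -> X}).
by apply: (@lipschitz_continuous _ _ _ k) => u v; rewrite -linearB hk.
Qed.

(** Equivalence of norms, one direction: the norm of [X], read in coordinates,
is continuous and positive on the compact unit sphere of the coordinate space,
hence bounded below there by a positive constant. *)
Lemma rVof_bounded : exists2 c : R, 0 < c & forall x, `|rVof e x| <= c * `|x|.
Proof.
pose S := [set v : 'rV[R]_n | `|v| = 1].
have [S0|S0] := pselect (S !=set0); last first.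
  (* the sphere is empty only in dimension 0 *)
  exists 1 => // x; have [->|vx0] := eqVneq (rVof e x) 0.
    by rewrite normr0 mulr_ge0.
  by case: S0; exists (`|rVof e x|^-1 *: rVof e x); apply: norm_normalize.
have Scomp : compact S.
  apply: bounded_closed_compact.
    by exists 1; split => // y y1 v /= ->; apply: ltW.
  rewrite (_ : S = Num.norm @^-1` [set 1])//.
  by apply: preimage_closed; [move=> v _; exact: norm_continuous | exact: closed_eq].
have nc : {within S, continuous (fun v => `|vecof e v|)}.
  apply: continuous_subspaceT => v.
  exact: (continuous_comp (@vecof_continuous v) (@norm_continuous _ _ _)).
have [v /set_mem Sv vmin] := compact_EVT_min S0 Scomp nc.
have v0 : 0 < `|vecof e v|.
  rewrite normr_gt0; apply/eqP => r0.
  have : v = 0 by apply: (can_inj (vecofK e_basis)); rewrite r0 linear0.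
  by move=> v0; move: Sv; rewrite /S /= v0 normr0 => /eqP; rewrite eq_sym oner_eq0.
exists (`|vecof e v|^-1); first by rewrite invr_gt0.
move=> x; have [->|vx0] := eqVneq (rVof e x) 0.
  by rewrite normr0 mulr_ge0// invr_ge0.
rewrite ler_pdivlMl//.
have nv : 0 < `|rVof e x| by rewrite normr_gt0.
have := vmin (`|rVof e x|^-1 *: rVof e x).
rewrite inE => /(_ (norm_normalize vx0)).
by rewrite linearZ /= (rVofK e_basis) normrZ normfV normr_id ler_pdivlMl// mulrC.
Qed.

Lemma linear_lipschitz (W : normedModType R) (h : {linear X -> W}) :
  exists2 k : R, 0 <= k & forall x, `|h x| <= k * `|x|.
Proof.
have [c c0 hc] := rVof_bounded.
pose K := \sum_(i < n) `|h e`_i|.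
have K0 : 0 <= K by apply: sumr_ge0.
exists (K * c); first by rewrite mulr_ge0// ltW.
move=> x; apply: (@le_trans _ _ (K * `|rVof e x|)); last first.
  by rewrite -mulrA ler_wpM2l.
rewrite -{1}(rVofK e_basis x) /vecof linear_sum mulr_suml.
apply: le_trans (ler_norm_sum _ _ _) _; apply: ler_sum => i _.
by rewrite linearZ /= normrZ mulrC ler_wpM2l// mx_entry_le_norm.
Qed.

Lemma linear_continuous_findim (W : normedModType R) (h : {linear X -> W}) :
  continuous h.
Proof.
have [k _ hk] := linear_lipschitz h.
by apply: (@lipschitz_continuous _ _ _ k) => u v; rewrite -linearB hk.
Qed.

Lemma bounded_closed_compact_findim (A : set X) :
  bounded_set A -> closed A -> compact A.
Proof.
move=> [M [Mr MA]] Acl.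
have -> : A = (vecof e) @` (vecof e @^-1` A).
  apply/seteqP; split => x /=; last by move=> [v Av <-].
  by move=> Ax; exists (rVof e x); rewrite /= (rVofK e_basis).
apply: continuous_compact; first exact/continuous_subspaceT/vecof_continuous.
apply: bounded_closed_compact; last first.
  by apply: preimage_closed => // v _; exact: vecof_continuous.
have [c c0 hc] := rVof_bounded.
exists (c * (M + 1)); split; first exact: num_real.
move=> y yM v /= Av; apply: ltW; apply: le_lt_trans yM.
rewrite -(vecofK e_basis v); apply: le_trans (hc _) _.
by rewrite (ler_wpM2l (ltW c0))//; apply: (MA (M + 1)) => //; rewrite ltrDl.
Qed.

Definition cball (c : X) (r : R) : set X := [set x | `|x - c| <= r].

Lemma cball_compact c r : compact (cball c r).
Proof.
apply: bounded_closed_compact_findim.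
  exists (r + `|c|); split; first exact: num_real.
  move=> y ry x /= xr; apply: ltW; apply: le_lt_trans ry.
  by rewrite -(subrK c x); apply: le_trans (ler_normD _ _) _; rewrite lerD2r.
rewrite (_ : cball c r = (fun x => `|x - c|) @^-1` [set y | y <= r])//.
apply: preimage_closed; last exact: closed_le.
move=> x _; apply: cvg_norm; apply: cvgB; [exact: cvg_id|exact: cvg_cst].
Qed.

(** A subspace is the zero set of [x |-> projv W x - x], which is linear and
hence continuous. *)
Lemma vspace_closed (W : {vspace X}) : closed [set x | x \in W].
Proof.
have -> : [set x | x \in W] = (fun x => projv W x - x) @^-1` [set 0].
  apply/seteqP; split => x /=.
    by move=> xW; rewrite projv_id// subrr.
  by move=> /eqP; rewrite subr_eq0 => /eqP <-; exact: memv_proj.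
apply: preimage_closed; last first.
  exact/accessible_closed_set1/hausdorff_accessible/norm_hausdorff.
move=> x _; apply: cvgB; last exact: cvg_id.
exact: (@linear_continuous_findim _ (projv W)).
Qed.

(** Turns a subspace given by a predicate into a [vspace]: among the [vspace]s
contained in [L], one of maximal dimension must be all of [L]. *)
Lemma linear_set_vspace (L : set X) :
  L 0 -> (forall (a : R) x y, L x -> L y -> L (a *: x + y)) ->
  exists W : {vspace X}, forall x, (x \in W) <-> L x.
Proof.
move=> L0 LD.
pose P m := `[< exists W : {vspace X}, \dim W = m /\ forall x, x \in W -> L x >].
have P0 : exists m, P m.
  exists 0%N; apply/asboolP; exists 0%VS; split; first exact: dimv0.
  by move=> x; rewrite memv0 => /eqP ->.
have Pb m : P m -> (m <= \dim {:X})%N.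
  by move=> /asboolP[W [<- _]]; exact/dimvS/subvf.
case: (ex_maxnP P0 Pb) => m /asboolP[W [dW WL]] nmax.
exists W => x; split; first exact: WL.
move=> Lx; apply/negPn/negP => xW.
have : (\dim (W + <[x]>)%VS <= m)%N.
  apply: nmax; apply/asboolP; exists (W + <[x]>)%VS; split => // y.
  move=> /memv_addP[u uW [v /vlineP[a ->] ->]].
  by rewrite addrC; apply: LD => //; exact: WL.
have [_] := dimv_leqif_sup (addvSl W <[x]>%VS).
rewrite dW subv_add subvv -memvE (negbTE xW) /= eqn_leq -{1}dW => + xn.
by rewrite dimvS ?addvSl// xn.
Qed.

Lemma affine_direction (S : set X) w : affine_set S -> S w ->
  exists W : {vspace X}, forall x, (x - w \in W) <-> S x.
Proof.
move=> Saff Sw.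
have SZ a u : S (w + u) -> S (w + a *: u).
  move=> Su; have := Saff _ _ a Su Sw.
  by rewrite scalerDr addrAC -scalerDl [a + _]addrC subrK scale1r.
have SD u v : S (w + u) -> S (w + v) -> S (w + (u + v)).
  move=> Su Sv; have := Saff _ _ 2^-1 Su Sv.
  rewrite (_ : 1 - 2^-1 = 2^-1 :> R); last by field.
  rewrite -scalerDr addrACA scalerDr -(mulr2n w) -(scaler_nat 2 w) scalerA.
  rewrite mulVf ?pnatr_eq0// scale1r => /(SZ 2).
  by rewrite scalerA mulfV ?pnatr_eq0// scale1r.
have [||W WP] := @linear_set_vspace [set u | S (w + u)].
- by rewrite /= addr0.
- by move=> a x y /= Sx Sy; apply: SD => //; exact: SZ.
- by exists W => x; rewrite WP /= addrC subrK.
Qed.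

Lemma affine_closed (S : set X) : affine_set S -> closed S.
Proof.
move=> Saff; have [[w Sw]|S0] := pselect (S !=set0); last first.
  suff -> : S = set0 by exact: closed0.
  by apply/seteqP; split => x // Sx; case: S0; exists x.
have [W WP] := affine_direction Saff Sw.
have -> : S = (fun x => x - w) @^-1` [set x | x \in W].
  by apply/seteqP; split => x /=; [move=> Sx; exact/WP|move/WP].
apply: preimage_closed; last exact: vspace_closed.
by move=> x _; apply: cvgB; [exact: cvg_id|exact: cvg_cst].
Qed.

Lemma affine_hull_affine (S : set X) : affine_set (affine_hull S).
Proof.
move=> x y t Sx Sy A hA; case: (hA) => Aaff _.
exact: (Aaff _ _ _ (Sx A hA) (Sy A hA)).
Qed.

Lemma sub_affine_hull (S : set X) : S `<=` affine_hull S.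
Proof. by move=> x Sx A [_]; apply. Qed.

Lemma affine_hull_min (S A : set X) :
  affine_set A -> S `<=` A -> affine_hull S `<=` A.
Proof. by move=> Aaff SA x; apply. Qed.

(** A finite-dimensional uniform boundedness principle: testing against the
vectors of a basis of [W] suffices, because
[|x| ^+ 2 = \sum_i coord i x * <b_i, x>] and each coordinate is at most a
constant times [|x|]. *)
Lemma vspace_inner_bounded (W : {vspace X}) (S : set X) :
  (forall x, S x -> x \in W) ->
  (forall u, u \in W -> exists C, forall x, S x -> '<u, x> <= C) ->
  exists r, forall x, S x -> `|x| <= r.
Proof.
move=> SW SC; pose b := vbasis W.
have bW i : b`_i \in W.
  have [ib|ib] := ltnP i (size b); first exact/vbasis_mem/mem_nth.
  by rewrite nth_default// mem0v.
have SC' i : exists C, forall x, S x -> `|'<(b`_i), x>| <= C.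
  have [C1 h1] := SC _ (bW i).
  have [C2 h2] : exists C, forall x, S x -> '<(- b`_i), x> <= C.
    by apply: SC; rewrite memvN.
  exists (Num.max C1 C2) => x Sx; rewrite ler_norml lerNl -innerNl !le_max.
  by rewrite h1// h2// orbT.
have [C hC] := choice SC'.
have hk (i : 'I_(\dim W)) :
    exists k : R, 0 <= k /\ forall x, `|coord b i x| <= k * `|x|.
  have [k k0 hk] := linear_lipschitz (coord b i : {linear X -> R^o}).
  by exists k.
have [k kP] := choice hk.
exists (\sum_(i < \dim W) k i * C i) => x Sx.
have [->|x0] := eqVneq x 0.
  rewrite normr0; apply: sumr_ge0 => i _; apply: mulr_ge0; first by have [] := kP i.
  by apply: le_trans (hC i x Sx).
rewrite -(@ler_pM2r _ `|x|) ?normr_gt0// -expr2 -inner_norm.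
rewrite {1}(coord_vbasis (SW _ Sx)) mulr_suml.
apply: (@le_trans _ _ (\sum_(i < \dim W) coord b i x * '<(b`_i), x>)).
  rewrite le_eqVlt; apply/orP; left; apply/eqP.
  elim/big_ind2 : _ => [|u p v q <- <-|i _]; rewrite ?innerE//.
  exact: linear0l.
apply: ler_sum => i _; apply: le_trans (ler_norm _) _.
rewrite normrM mulrAC ler_pM//; last exact: hC.
by have [_] := kP i; exact.
Qed.

End FiniteDimension.

(** * The range of a firmly nonexpansive map *)

Section FirmlyNonexpansiveRange.
Context {R : realType} {X : finHilbertType R}.
Implicit Types x y z : X.

Variables (N : X -> X) (D : set X).
Hypothesis N_firm :
  forall x y, 0 <= '<(N x - N y), ((x - N x) - (y - N y))>.
Hypothesis N_sub : range N `<=` D.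
Hypothesis N_rect : forall v, D v -> exists C, forall x, - C <= '<(N x - v), x>.

Let sum_increments x y : (N x - N y) + ((x - N x) - (y - N y)) = x - y.
Proof. by rewrite addrACA -opprD [N x + _]addrC [N y + _]addrC !subrK. Qed.

Let N_nonexp x y : `|N x - N y| <= `|x - y|.
Proof. by rewrite -(sum_increments x y); exact: ler_normD_inner_ge0. Qed.

Let coN_nonexp x y : `|(x - N x) - (y - N y)| <= `|x - y|.
Proof.
rewrite -(sum_increments x y) [X in _ <= `|X|]addrC.
by apply: ler_normD_inner_ge0; rewrite innerC.
Qed.

(** The equation says that [x] is a fixed point of
[P x = (w + (x - N x)) / (1 + e)], a strict contraction because [x - N x] is
nonexpansive.  A fixed point is found as a minimizer of [|x - P x|] over a
ball that [P] maps to itself: applying [P] to the minimizer would otherwise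
decrease this distance. *)
Lemma regularized_surj (e : R) w : 0 < e -> exists x, e *: x + N x = w.
Proof.
move=> e0; pose k := (1 + e)^-1.
have e1 : 0 < 1 + e by rewrite addr_gt0.
have k0 : 0 < k by rewrite invr_gt0.
have k1 : k < 1 by rewrite invf_lt1// ltrDl.
pose P x := k *: (w + (x - N x)).
have PL x y : `|P x - P y| <= k * `|x - y|.
  rewrite /P -scalerBr normrZ (gtr0_norm k0) (ler_wpM2l (ltW k0))//.
  rewrite opprD addrACA subrr add0r; exact: coN_nonexp.
pose r := (`|w| + `|N 0|) / e.
have Pball x : `|x - 0| <= r -> `|P x - 0| <= r.
  rewrite !subr0 => xr; rewrite normrZ (gtr0_norm k0) ler_pdivrMl//.
  have h := coN_nonexp x 0; rewrite sub0r opprK subr0 in h.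
  have h1 := ler_normD w (x - N x).
  have h2 := ler_normD ((x - N x) + N 0) (- N 0); rewrite addrK normrN in h2.
  have re : e * r = `|w| + `|N 0| by rewrite /r mulrC divfK// gt_eqF.
  by rewrite mulrDl mul1r re; lra.
have [x /set_mem xr xmin] : exists2 x, x \in cball 0 r &
    forall y, y \in cball 0 r -> `|x - P x| <= `|y - P y|.
  apply: compact_EVT_min.
  - by exists 0; rewrite /cball /= subrr normr0 divr_ge0// ltW.
  - exact: cball_compact.
  apply: continuous_subspaceT; apply: (@lipschitz_continuous _ _ _ 2) => x y.
  apply: le_trans (ler_dist_dist _ _) _.
  have -> : x - P x - (y - P y) = (x - y) - (P x - P y).
    by rewrite !opprB addrACA [in RHS]addrACA (addrC (- P x)).
  have := ler_normB (x - y) (P x - P y); have := PL x y.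
  have : k * `|x - y| <= `|x - y| by rewrite ler_piMl// ltW.
  lra.
have := xmin (P x); rewrite inE => /(_ (Pball _ xr)) h1.
have h2 := PL x (P x).
have h3 : `|x - P x| <= 0.
  rewrite -(@pmulr_rle0 _ (1 - k)) ?subr_gt0//; lra.
move: h3; rewrite normr_le0 subr_eq0 => /eqP xP.
exists x; have : (1 + e) *: x = w + (x - N x).
  by rewrite {1}xP scalerA mulfV ?scale1r// gt_eqF.
rewrite scalerDl scale1r => xw.
have -> : e *: x = (x + e *: x) - x by rewrite addrAC subrr add0r.
by rewrite xw addrA [_ - N x - x]addrAC addrK subrK.
Qed.

(** Substitute [N x = w - e *: x] in the hypothesis [N_rect].  The constant
depends neither on [e] nor on [w]. *)
Lemma regularized_bound v : D v -> exists C, forall e w x, 0 < e ->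
  e *: x + N x = w -> '<(v - w), x> + e * '<x, x> <= C.
Proof.
move=> /N_rect[C hC]; exists C => e w x e0 <-.
have := hC x; rewrite !innerE; lra.
Qed.

(** With [w := v] the previous bound reads [e * |x| ^+ 2 <= C], so that
[|N x - v| ^+ 2 = e * (e * |x| ^+ 2)] tends to 0 with [e]. *)
Lemma range_dense : D `<=` closure (range N).
Proof.
move=> v /regularized_bound[C hC] B /nbhs_normP[d /= d0 dB].
pose e := d ^+ 2 / (`|C| + 1).
have C1 : 0 < `|C| + 1 by rewrite ltr_wpDl.
have e0 : 0 < e by rewrite divr_gt0// exprn_gt0.
have [x xv] := regularized_surj v e0.
exists (N x); split; first by exists x.
apply: dB => /=; rewrite -xv addrK -(@ltr_pXn2r _ 2) ?nnegrE ?(ltW d0)//.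
have := hC _ _ _ e0 xv; rewrite subrr linear0l add0r => h.
rewrite -inner_norm !innerE.
apply: le_lt_trans (ler_wpM2l (ltW e0) h) _.
rewrite /e -mulrA mulrC -ltr_pdivlMr ?exprn_gt0// divff ?gt_eqF ?exprn_gt0//.
by rewrite mulrC ltr_pdivrMr// mul1r (le_lt_trans (ler_norm _))// ltrDl.
Qed.

(** Affine sets are closed, so the affine hull of the range contains the closure
of the range, hence [D]. *)
Lemma affine_hull_range : affine_hull (range N) = affine_hull D.
Proof.
apply/seteqP; split; apply: affine_hull_min; try exact: affine_hull_affine.
  by move=> x /N_sub; exact: sub_affine_hull.
move=> x /range_dense Dx.
have := affine_closed (@affine_hull_affine _ _ (range N)).
move=> /closure_id ->; move: Dx; apply: closureS; exact: sub_affine_hull.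
Qed.

Lemma rel_interiorP (S : set X) w : rel_interior S w <->
  affine_hull S w /\ exists2 d, 0 < d &
    forall y, affine_hull S y -> `|w - y| < d -> S y.
Proof.
split=> [[Sw]|[Sw [d d0 dS]]]; last first.
  split => //; rewrite /within /=; apply/nbhs_normP; exists d => //= y yd Sy.
  exact: dS.
rewrite /within /= => /nbhs_normP[d /= d0 dS]; split => //; exists d => // y Sy yd.
exact: dS.
Qed.

(** The heart of the argument.  The solutions [x] of [e *: x + N x = w] are
parallel to the affine hull of [D], since [e *: x = w - N x] is a difference of
two of its points.  As [w] is a relative interior point, [w + s *: u] lies in
[D] for each direction [u] of that hull and some small [s > 0], and
[regularized_bound] bounds [<u, x>] uniformly in [e].  The solutions therefore
stay in a ball; there [|N x - w| = e * |x|] becomes arbitrarily small, and by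
compactness the value [w] is attained. *)
Lemma rel_interior_sub_range : rel_interior D `<=` range N.
Proof.
move=> w /rel_interiorP[wD [d d0 dD]].
have [W WP] := affine_direction (@affine_hull_affine _ _ D) wD.
pose S := [set x | exists2 e, 0 < e & e *: x + N x = w].
have [r hr] : exists r, forall x, S x -> `|x| <= r.
  apply: (@vspace_inner_bounded _ _ W).
    move=> x [e e0 xw]; suff : - (e *: x) \in W.
      by rewrite memvN => /(memvZ e^-1); rewrite scalerA mulVf ?scale1r// gt_eqF.
    rewrite (_ : - _ = N x - w); last by rewrite -xw opprD addrCA subrr addr0.
    apply/WP; apply: sub_affine_hull; by apply: N_sub; exists x.
  move=> u uW; pose s := d / (`|u| + 1).
  have u1 : 0 < `|u| + 1 by rewrite ltr_wpDl.
  have s0 : 0 < s by rewrite divr_gt0.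
  have : D (w + s *: u).
    apply: dD; first by apply/WP; rewrite addrC addKr memvZ.
    rewrite opprD addrA subrr add0r normrN normrZ gtr0_norm// /s.
    by rewrite mulrAC ltr_pdivrMr// ltr_pM2l// ltrDl.
  move=> /regularized_bound[C hC]; exists (C / s) => x [e e0 xw].
  have := hC _ _ _ e0 xw; rewrite addrAC subrr add0r innerZl ler_pdivlMr// mulrC.
  have : 0 <= e * '<x, x> by rewrite mulr_ge0 ?inner_sqr_ge0// ltW.
  lra.
have r0 : 0 <= r.
  have [x xw] := regularized_surj w ltr01.
  by apply: le_trans (hr x _) => //; exists 1.
have [x /set_mem xr xmin] : exists2 x, x \in cball 0 r &
    forall y, y \in cball 0 r -> `|N x - w| <= `|N y - w|.
  apply: compact_EVT_min; first by exists 0; rewrite /cball /= subrr normr0.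
    exact: cball_compact.
  apply: continuous_subspaceT; apply: (@lipschitz_continuous _ _ _ 1) => x y.
  by rewrite mul1r; apply: le_trans (ler_dist_dist _ _) _; rewrite opprB addrA subrK.
exists x => //; apply/eqP; rewrite -subr_eq0 -normr_le0 leNgt; apply/negP => h0.
have r1 : 0 < r + 1 by rewrite ltr_wpDl.
have e0 : 0 < `|N x - w| / (r + 1) by rewrite divr_gt0.
have [y yw] := regularized_surj w e0.
have yr : `|y| <= r by apply: hr; exists (`|N x - w| / (r + 1)).
have := xmin y; rewrite inE /cball /= subr0 => /(_ yr).
rewrite -{2}yw opprD addrCA subrr addr0 normrN normrZ gtr0_norm//.
apply/negP; rewrite -ltNge mulrAC ltr_pdivrMr// ltr_pM2l//.
by apply: le_lt_trans yr _; rewrite ltrDl.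
Qed.

(** Since the range lies between the relative interior of [D] and [D], and has
the same affine hull as [D], the relative interiors agree. *)
Lemma range_near_equal : near_equal (range N) D.
Proof.
split.
  apply/seteqP; split; first exact: closureS.
  move=> x /(closureS range_dense); rewrite -(iffLR (closure_id _))//.
  exact: closed_closure.
apply/seteqP; split => w /rel_interiorP[wL [d d0 dS]].
  apply/rel_interiorP; rewrite -affine_hull_range; split => //.
  by exists d => // y yL yd; apply/N_sub/dS.
apply/rel_interiorP; rewrite affine_hull_range; split => //.
exists (d / 2); first by rewrite divr_gt0.
move=> y yL yd; apply: rel_interior_sub_range; apply/rel_interiorP; split => //.
exists (d / 2); first by rewrite divr_gt0.
move=> z zL zd; apply: dS => //.
have := ler_normD (w - y) (y - z); rewrite addrA subrK; lra.
Qed.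

End FirmlyNonexpansiveRange.

(** * Proximal points *)

(** The sublevel sets [B y] inside [K] form a filter base because the values of
[phi] are totally ordered; at a cluster point, lower semicontinuity excludes a
value above that of any [y] in [K]. *)
Lemma lsc_attains_min {R : realType} {T : topologicalType} (phi : T -> \bar R)
    (K : set T) : lower_semicontinuous phi -> (forall x, -oo < phi x)%E ->
  compact K -> K !=set0 ->
  exists2 a, K a & forall y, K y -> (phi a <= phi y)%E.
Proof.
move=> phi_lsc phiN Kc [y0 Ky0].
pose B y := [set x | K x /\ (phi x <= phi y)%E].
have FF : Filter (filter_from K B).
  apply: filter_from_filter; first by exists y0.
  move=> y z Ky Kz; have [yz|zy] := leP (phi y) (phi z).
    by exists y => // x [Kx xy]; split; split => //; exact: le_trans yz.
  by exists z => // x [Kx xz]; split; split => //; exact: le_trans (ltW zy).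
have PF : ProperFilter (filter_from K B).
  by apply: filter_from_proper => // y Ky; exists y; split.
have FK : filter_from K B K by exists y0 => // x [].
have [a [Ka aF]] := Kc _ PF FK.
exists a => // y Ky; rewrite leNgt; apply/negP => ya.
have [r ry] : exists r : R, phi y = r%:E.
  move: (phiN y) ya; case: (phi y) => [r _ _|_|]; first by exists r.
    by rewrite ltNge leey.
  by rewrite ltxx.
rewrite ry in ya; have [V Va Vr] := phi_lsc _ _ ya.
have [|x [[Kx]]] := aF (B y) V _ Va; first by exists y.
by move=> + /Vr; rewrite ry leNgt => /negbTE ->.
Qed.

Lemma lsc_add_continuous {R : realType} {T : topologicalType}
    (phi : T -> \bar R) (q : T -> R) :
  lower_semicontinuous phi -> continuous q ->
  lower_semicontinuous (fun x => phi x + (q x)%:E)%E.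
Proof.
move=> phi_lsc q_cont x c cx.
have [e e0 ce] : exists2 e : R, 0 < e & ((c - q x + e)%:E < phi x)%E.
  move: cx; case: (phi x) => [s| |] /=; last by rewrite ltNge leNye.
    rewrite -EFinD lte_fin => cx; exists ((s + q x - c) / 2); first lra.
    rewrite lte_fin; lra.
  by move=> _; exists 1 => //; rewrite ltry.
have [V Vx Vc] := phi_lsc _ _ ce.
exists (V `&` [set y | q x - e < q y]).
  apply: filterI => //.
  by apply: (cvgr_gt (q x)); [exact: q_cont | rewrite ltrBlDr ltrDl].
move=> y [/Vc + /= qy]; case: (phi y) => [s| |] /=.
- by rewrite -EFinD !lte_fin => cs; lra.
- by rewrite !ltry.
- by rewrite ltNge leNye.
Qed.

Section Proximity.
Context {R : realType} {X : finHilbertType R}.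
Variable f : X -> \bar R.
Hypotheses (f_proper : eproper f) (f_lsc : lower_semicontinuous f)
  (f_convex : econvex f).

Lemma edom_fin x : edom f x -> exists r : R, f x = r%:E.
Proof.
case: f_proper => /(_ x); rewrite /edom /=.
case: (f x) => [r _ _ _|_ _|]; first by exists r.
- by rewrite ltxx.
- by rewrite ltxx.
Qed.

(** Compactness gives a lower bound [m] for [f] on the unit ball around a point
[y0] of the domain.  For [y] outside this ball, convexity along the segment from
[y0] to [y], at the point where it leaves the ball, propagates the bound with at
most linear decay.  The form [1 + |y - y0|] also covers the ball itself. *)
Lemma proper_convex_norm_minorant : exists y0 (f0 : R), f y0 = f0%:E /\
  exists2 d : R, 0 <= d & forall y, ((f0 - d * (1 + `|y - y0|))%:E <= f y)%E.
Proof.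
have [fN [y0 y0f]] := f_proper.
have [f0 f0E] := edom_fin y0f.
have y0B : cball y0 1 y0 by rewrite /cball /= subrr normr0.
have [z zB zmin] := lsc_attains_min f_lsc fN (@cball_compact _ _ y0 1)
  (ex_intro _ _ y0B).
have [m mE] : exists r : R, f z = r%:E.
  by apply: edom_fin; rewrite /edom /=; apply: le_lt_trans (zmin _ y0B) _.
have mf0 : m <= f0 by have := zmin _ y0B; rewrite mE f0E lee_fin.
exists y0, f0; split => //; exists (f0 - m); first by rewrite subr_ge0.
move=> y; have [yB|yB] := leP `|y - y0| 1.
  apply: le_trans (zmin _ yB); rewrite mE lee_fin.
  have : 0 <= (f0 - m) * `|y - y0| by rewrite mulr_ge0// subr_ge0.
  lra.
set r := `|y - y0| in yB *.
have r0 : 0 < r by apply: lt_trans yB.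
have r1 : 0 < r^-1 < 1 by rewrite invr_gt0 r0 invf_lt1.
have zB' : cball y0 1 (r^-1 *: y + (1 - r^-1) *: y0).
  rewrite /cball /= scalerBl scale1r addrCA [y0 + _]addrC addrK -scalerBr.
  by rewrite normrZ gtr0_norm ?invr_gt0// -/r mulVf// gt_eqF.
have := le_trans (zmin _ zB') (f_convex y y0 r1); rewrite mE f0E.
have := fN y; case: (f y) => [s| |]// _; last by rewrite leey.
rewrite -!EFinM -EFinD !lee_fin => h.
have : r * m <= r * (r^-1 * s + (1 - r^-1) * f0) by rewrite ler_wpM2l// ltW.
rewrite mulrDr mulrA mulfV ?gt_eqF// mul1r mulrA mulrBr mulr1 mulfV ?gt_eqF//.
nra.
Qed.

(** The quadratic term beats a decay of [f] that is linear in [|y - y0|]: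
outside a ball around [y0] the objective exceeds its value at [y0], so that a
minimizer over this compact ball is a global one. *)
Lemma prox_minimizer x : exists2 a, edom f a & forall y,
  (f a + (2^-1 * '<(a - x), (a - x)>)%:E <= f y + (2^-1 * '<(y - x), (y - x)>)%:E)%E.
Proof.
have [fN _] := f_proper.
have [y0 [f0 [f0E [d d0 fb]]]] := proper_convex_norm_minorant.
pose q y := 2^-1 * '<(y - x), (y - x)>.
have q0 y : 0 <= q y by rewrite mulr_ge0 ?inner_sqr_ge0// invr_ge0.
have q_cont : continuous q.
  move=> y; rewrite /q; under eq_fun do rewrite inner_norm expr2.
  apply: cvgM; first exact: cvg_cst.
  have qc : `|z - x| @[z --> y] --> `|y - x|.
    by apply: cvg_norm; apply: cvgB; [exact: cvg_id|exact: cvg_cst].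
  exact: (cvgM qc qc).
pose phi y := (f y + (q y)%:E)%E.
have phi_lsc : lower_semicontinuous phi by exact: lsc_add_continuous.
have phiN y : (-oo < phi y)%E.
  by rewrite /phi; have := fN y; case: (f y) => [s| |] //= _; rewrite ?ltNyr.
pose s := `|x - y0|.
have s0 : 0 <= s by exact: normr_ge0.
(* For [t >= r], [t * (t / 2 - s - d) >= d], which is the inequality
   [(t - s) ^+ 2 / 2 - d * (1 + t) >= s ^+ 2 / 2] needed below. *)
pose r := 2 * (s + 2 * d) + 1.
have y0r : cball y0 r y0 by rewrite /cball /= subrr normr0 /r; lra.
have [a ar amin] := lsc_attains_min phi_lsc phiN (@cball_compact _ _ y0 r)
  (ex_intro _ _ y0r).
have a_min y : (phi a <= phi y)%E.
  have [yr|yr] := leP `|y - y0| r; first exact: amin.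
  apply: le_trans (amin _ y0r) _.
  apply: (@le_trans _ _ ((f0 - d * (1 + `|y - y0|)) + q y)%:E); last first.
    by rewrite EFinD leeD2r.
  rewrite /phi f0E -EFinD lee_fin /q !inner_norm distrC -/s.
  set t := `|y - y0| in yr *.
  have tx : t - s <= `|y - x|.
    by rewrite lerBlDr /t /s (le_trans _ (ler_normD _ _))// addrA subrK.
  have : (t - s) ^+ 2 <= `|y - x| ^+ 2.
    have ts : 0 <= t - s by rewrite subr_ge0 (le_trans _ (ltW yr))// /r; lra.
    by rewrite ler_pXn2r ?nnegrE.
  rewrite /r in yr *; nra.
exists a => //; apply: le_lt_trans (_ : (phi y0 < +oo)%E); last first.
  by rewrite /phi f0E -EFinD ltry.
by apply: le_trans (a_min y0); rewrite /phi leeDl// lee_fin.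
Qed.

(** Minty surjectivity of [Id + subdifferential f]: compare the minimizer [a]
with [t *: y + (1 - t) *: a], divide by [t] and take [t] small. *)
Lemma prox_exists x : exists a, subdifferential f a (x - a).
Proof.
have [a /edom_fin[fa faE] amin] := prox_minimizer x.
have [fN _] := f_proper.
exists a => y /=; rewrite faE -EFinD.
case E : (f y) => [fy| |]; [|by rewrite leey|by have := fN y; rewrite E].
rewrite lee_fin.
pose c := '<(y - a), (a - x)>; pose Q := '<(y - a), (y - a)>.
have cE : '<(y - a), (x - a)> = - c by rewrite -innerNr opprB.
have key t : 0 < t < 1 -> 0 <= fy - fa + c + t * (2^-1 * Q).
  move=> t01; have := amin (t *: y + (1 - t) *: a).
  rewrite faE -EFinD => h.
  have := f_convex y a t01; rewrite E faE -!EFinM -EFinD => h2.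
  have := le_trans h (leeD2r _ h2); rewrite -EFinD lee_fin.
  have -> : t *: y + (1 - t) *: a - x = t *: (y - a) + (a - x).
    by rewrite scalerBl scale1r scalerBr !addrA addrAC.
  rewrite !(innerDl (t *: _)) !(innerDr (t *: _)) !innerZl !innerZr.
  rewrite [inner (a - x) (y - a)]innerC -/c -/Q => h3.
  have : 0 <= t * (fy - fa + c + t * (2^-1 * Q)) by lra.
  by rewrite pmulr_rge0//; case/andP: t01.
rewrite cE leNgt; apply/negP => neg.
pose z := fa - c - fy.
have z0 : 0 < z by rewrite /z; lra.
have Q0 : 0 <= Q by exact: inner_sqr_ge0.
have zQ : 0 < Q + 2 * z by lra.
have t01 : 0 < z / (Q + 2 * z) < 1.
  by rewrite divr_gt0//= ltr_pdivrMr// mul1r; lra.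
have := key _ t01.
(* this value of [t] makes the quadratic term smaller than the gap [z] *)
have : z / (Q + 2 * z) * (2^-1 * Q) < z.
  rewrite mulrAC ltr_pdivrMr//; nra.
rewrite /z; lra.
Qed.

End Proximity.

(** * Rectangular operators *)

Section RectangularOperators.
Context {R : realType} {X : finHilbertType R}.
Implicit Types A F H : X -> set X.

(** Monotone operators that are rectangular (also called 3* monotone) on
[D `*` S].  For a subdifferential, [rect_bound] is the Fenchel-Young inequality
applied to the pairs [(x, q)] and [(p, u)].  The sets [D] and [S] may be larger
than the domain and the range of [A], which lets them be [dom f] and [dom f^*].
Unlike subdifferentials, this notion is visibly stable under inversion. *)
Record rectangular_on A (D S : set X) : Prop := Rectangular {
  rect_mono : forall x u y v, A x u -> A y v -> 0 <= '<(x - y), (u - v)>;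
  rect_dom : forall x u, A x u -> D x;
  rect_ran : forall x u, A x u -> S u;
  rect_bound : forall p q, D p -> S q -> exists c : R,
    forall x u, A x u -> '<x, q> + '<p, u> <= '<x, u> + c }.

Lemma rectangular_inv A D S : rectangular_on A D S -> rectangular_on (op_inv A) S D.
Proof.
move=> [mono dom ran bound]; split.
- by move=> x u y v Aux Avy; rewrite innerC; exact: mono.
- by move=> x u /ran.
- by move=> x u /dom.
- move=> p q Sp Dq; have [c hc] := bound _ _ Dq Sp; exists c => x u Aux.
  by rewrite addrC (innerC p) (innerC x q) (innerC x); exact: hc.
Qed.

(** A point is written as [x = a + u] with [u := a - b - v] in [F a] and [v] in
[H b]; its displacement is [N x = a - b = u + v] and its image is
[x - N x = a - v].  Two identities carry the proof.  For increments,
[<dN, d(x - N)> = <da, du> + <db, dv> >= 0], so that [N] is firmly nonexpansive.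
For [w = p - q = p' + q'], the rectangularity of [F] and [H] at [(p, p')] and
[(q, q')] and the identity
[<a, u> - <b, v> + <v, a> - <b, u> = |N x| ^+ 2] give
[<N x - w, x> >= |N x| ^+ 2 + <N x, q - q'> - const], which is bounded
below. *)
Lemma rectangular_displacement_range F H (DF SF DH SH : set X) :
  rectangular_on F DF SF -> rectangular_on H DH SH ->
  (forall x, exists a b v, [/\ F a (a - b - v), H b v & x = a + (a - b - v)]) ->
  [set z | exists a b v, [/\ F a (a - b - v), H b v & z = a - b]] ≃
    set_sub DF DH `&` set_add SF SH.
Proof.
move=> rF rH solve.
have /choice[P PE] : forall x, exists p : X * X * X, let: (a, b, v) := p in
    [/\ F a (a - b - v), H b v & x = a + (a - b - v)].
  by move=> x; have [a [b [v h]]] := solve x; exists (a, b, v).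
pose N x := let: (a, b, _) := P x in a - b.
have split_x (a b v : X) : a + (a - b - v) = (a - b) + (a - v).
  by rewrite addrCA.
have gap a b v a' b' v' : F a (a - b - v) -> H b v ->
    F a' (a' - b' - v') -> H b' v' ->
    0 <= '<((a - b) - (a' - b')), ((a - v) - (a' - v'))>.
  move=> Fa Hb Fa' Hb'.
  have := rect_mono rF Fa Fa'; have := rect_mono rH Hb Hb'.
  have opp2 (p q p' q' : X) : p - q - (p' - q') = (p - p') - (q - q').
    by rewrite !opprB addrACA [in RHS]addrACA [- q + _]addrC.
  rewrite (opp2 (a - b) v) (opp2 a b) (opp2 a v).
  move: (a - a') (b - b') (v - v') => da db dv.
  rewrite !innerE (innerC db da); lra.
have NE a b v : F a (a - b - v) -> H b v -> N (a + (a - b - v)) = a - b.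
  move=> Fa Hb; rewrite /N; have := PE (a + (a - b - v)).
  case: (P _) => [[a' b'] v'] [Fa' Hb' E].
  have := ler_normD_inner_ge0 (gap _ _ _ _ _ _ Fa Hb Fa' Hb').
  rewrite addrACA -opprD -!split_x -E subrr normr0 normr_le0 subr_eq0.
  by move=> /eqP.
have rangeE : [set z | exists a b v, [/\ F a (a - b - v), H b v & z = a - b]] = range N.
  apply/seteqP; split=> [_ [a [b [v [Fa Hb ->]]]]|_ [x _ <-]] /=.
    by exists (a + (a - b - v)) => //; exact: NE.
  by rewrite /N; have := PE x; case: (P x) => [[a b] v] [Fa Hb _]; exists a, b, v.
have NP x : exists a b v, [/\ F a (a - b - v), H b v,
    x = a + (a - b - v), N x = a - b & x - N x = a - v].
  rewrite /N; have := PE x; case: (P x) => [[a b] v] [Fa Hb xE].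
  exists a, b, v; split => //; first by rewrite xE split_x addrC addKr.
rewrite rangeE; apply: range_near_equal.
- move=> x y; have [a [b [v [Fa Hb _ -> ->]]]] := NP x.
  by have [a' [b' [v' [Fa' Hb' _ -> ->]]]] := NP y; exact: gap.
- move=> _ [x _ <-]; have [a [b [v [Fa Hb xE NxE cx]]]] := NP x.
  split.
    rewrite NxE; exists a; first exact: (rect_dom rF Fa).
    by exists b => //; exact: (rect_dom rH Hb).
  exists (a - b - v); first exact: (rect_ran rF Fa).
  by exists v; [exact: (rect_ran rH Hb)|rewrite subrK].
- move=> w [[p Dp [q Dq wE]] [p' Sp' [q' Sq' wE']]].
  have [c hc] := rect_bound rF Dp Sp'; have [c' hc'] := rect_bound rH Dq Sq'.
  pose e := q - q'; exists (c + c' + '<e, e>) => x.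
  have [a [b [v [Fa Hb xE -> cx]]]] := NP x.
  have := hc _ _ Fa; have := hc' _ _ Hb.
  have := inner_sqr_ge0 (a - b); have := inner_sqr_ge0 e.
  have := inner_sqr_ge0 (a - b + e).
  have -> : '<(a - b - w), x> = '<(a - b), x> - '<p', a> - '<q', a>
      - '<p, (a - b - v)> + '<q, (a - b - v)>.
    by rewrite innerDl innerNl xE (innerDr a _ w) -{1}wE' -wE !innerE; lra.
  rewrite xE /e !innerE.
  (* the two sides agree only up to the symmetry of the inner product *)
  have := (innerC a b, innerC a p', innerC a q', innerC b q', innerC a q,
    innerC b q, innerC q q', innerC a v, innerC b v).
  do 8! case; lra.
Qed.

End RectangularOperators.

(** * Subdifferentials and the Douglas-Rachford operator *)

Section DouglasRachford.
Context {R : realType} {X : finHilbertType R}.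
Implicit Types f g : X -> \bar R.

Lemma subdifferential_edom f x u : eproper f -> subdifferential f x u -> edom f x.
Proof.
move=> [fN [y fy]] /(_ y); rewrite /edom /= in fy *.
have := fN x; case: (f x) => [s| |]//= _; rewrite ?ltry//.
by rewrite addye// leye_eq => /eqP fyE; rewrite fyE in fy.
Qed.

Lemma subdifferential_conjugate f x u :
  eproper f -> subdifferential f x u -> edom (fenchel_conjugate f) u.
Proof.
move=> fp fxu; have [fN _] := fp.
have [r fx] := edom_fin fp (subdifferential_edom fp fxu).
rewrite /edom /= /fenchel_conjugate.
apply: (@le_lt_trans _ _ ('<x, u> - r)%:E); last exact: ltry.
apply: ub_ereal_sup => _ [y _ <-].
have := fxu y; have := fN y; rewrite fx -EFinD; case: (f y) => [s| |]//= _.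
  rewrite -EFinB !lee_fin !innerE; lra.
by rewrite leNye.
Qed.

Lemma fenchel_young_bound f p u : eproper f ->
  edom f p -> edom (fenchel_conjugate f) u ->
  exists c, forall x v, subdifferential f x v -> '<x, u> + '<p, v> <= '<x, v> + c.
Proof.
move=> fp pf uf; have [fN _] := fp.
have [fp0 fpE] := edom_fin fp pf.
have : (('<p, u>)%:E - f p <= fenchel_conjugate f u)%E.
  by apply: ereal_sup_ubound; exists p.
rewrite fpE -EFinB; move: uf; rewrite /edom /=.
case E : (fenchel_conjugate f u) => [c| |]// _ _.
exists (fp0 + c) => x v fxv.
have [fx fxE] := edom_fin fp (subdifferential_edom fp fxv).
have : (('<x, u>)%:E - f x <= fenchel_conjugate f u)%E.
  by apply: ereal_sup_ubound; exists x.
rewrite E fxE -EFinB lee_fin.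
have := fxv p; rewrite fxE fpE -EFinD lee_fin !innerE; lra.
Qed.

Lemma subdifferential_monotone f x u y v : eproper f ->
  subdifferential f x u -> subdifferential f y v -> 0 <= '<(x - y), (u - v)>.
Proof.
move=> fp fxu fyv.
have [fx fxE] := edom_fin fp (subdifferential_edom fp fxu).
have [fy fyE] := edom_fin fp (subdifferential_edom fp fyv).
have := fxu y; have := fyv x; rewrite fxE fyE -!EFinD !lee_fin !innerE; lra.
Qed.

Lemma subdifferential_rectangular f : eproper f ->
  rectangular_on (subdifferential f) (edom f) (edom (fenchel_conjugate f)).
Proof.
move=> fp; split.
- by move=> x u y v; exact: subdifferential_monotone.
- by move=> x u; exact: subdifferential_edom.
- by move=> x u; exact: subdifferential_conjugate.
- by move=> p u; exact: fenchel_young_bound.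
Qed.

Lemma resolventP (A : X -> set X) x a : resolvent A x a <-> A a (x - a).
Proof.
split=> [[_ /= -> [u Au <-]]|Aa]; first by rewrite addrC addKr.
by exists a => //; exists (x - a) => //; rewrite addrC subrK.
Qed.

Lemma reflected_resolventP (A : X -> set X) x y :
  reflected_resolvent A x y <-> exists2 a, A a (x - a) & y = a - (x - a).
Proof.
split=> [[_ [a /resolventP Aa <-] [_ -> <-]]|[a Aa ->]].
  by exists a => //; rewrite opprB addrA scaler_nat mulr2n.
exists (2 *: a); first by exists a => //; apply/resolventP.
by exists x => //; rewrite opprB addrA scaler_nat mulr2n.
Qed.

(** The parametrization by [a = J_A x], [b = J_B (R_A x)] and [v = R_A x - b], in
which both [x - T x = a - b] and [T x = a - v] are linear, and the latter is the
former with [b] and [v] exchanged. *)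
Lemma douglas_rachfordP (A B : X -> set X) x y :
  douglas_rachford A B x y <->
  exists a b v, [/\ A a (a - b - v), B b v, x = a + (a - b - v) & y = a - v].
Proof.
have half (a b v : X) : 2^-1 *: (a + (a - b - v)) + 2^-1 *: (b - v) = a - v.
  rewrite -scalerDr [a - b - v]addrAC !addrA subrK [a + a - v]addrAC.
  rewrite -[a - v + a - v]addrA -mulr2n -(scaler_nat 2 (a - v)) scalerA.
  by rewrite mulVf ?pnatr_eq0// scale1r.
split.
  move=> [_ [_ -> <-] [_ [_ [z /reflected_resolventP[a Aa ->]
    /reflected_resolventP[b Bb ->]] <-] <-]].
  have E : a - b - (a - (x - a) - b) = x - a.
    by rewrite opprB addrA subrK opprB addrC subrK.
  exists a, b, (a - (x - a) - b); split => //; rewrite ?E //.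
    by rewrite addrC subrK.
  by rewrite -(half a b) E [a + (x - a)]addrC subrK.
move=> [a [b [v [Aa Bb -> ->]]]].
exists (2^-1 *: (a + (a - b - v))); first by exists (a + (a - b - v)).
exists (2^-1 *: (b - v)); last exact: half.
exists (b - v) => //; exists (b + v).
  apply/reflected_resolventP; exists a.
    by rewrite [a + _ - a]addrAC subrr add0r.
  rewrite [a + _ - a]addrAC subrr add0r -[a - b - v]addrA -opprD opprB.
  by rewrite [RHS]addrC subrK.
by apply/reflected_resolventP; exists b; rewrite [b + v - b]addrAC subrr add0r.
Qed.

Lemma douglas_rachford_solvable f g :
  eproper f -> lower_semicontinuous f -> econvex f ->
  eproper g -> lower_semicontinuous g -> econvex g ->
  forall x, exists a b v, [/\ subdifferential f a (a - b - v),
    subdifferential g b v & x = a + (a - b - v)].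
Proof.
move=> f_proper f_lsc f_convex g_proper g_lsc g_convex x.
have [a fa] := prox_exists f_proper f_lsc f_convex x.
have [b gb] := prox_exists g_proper g_lsc g_convex (a - (x - a)).
exists a, b, (a - (x - a) - b).
have -> : a - b - (a - (x - a) - b) = x - a.
  by rewrite opprB addrA subrK opprB addrC subrK.
by split => //; rewrite addrC subrK.
Qed.

End DouglasRachford.

Theorem corollary6p5 (R : realType) (X : finHilbertType R) (f g : X -> \bar R)
    (f_proper : eproper f) (f_lsc : lower_semicontinuous f) (f_convex : econvex f)
    (g_proper : eproper g) (g_lsc : lower_semicontinuous g) (g_convex : econvex g) :
  let T := douglas_rachford (subdifferential f) (subdifferential g) in
  let fs := fenchel_conjugate f in
  let gs := fenchel_conjugate g in
  (op_range (op_sub op_id T)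
     ≃ set_sub (edom f) (edom g) `&` set_add (edom fs) (edom gs)) /\
  (op_range T
     ≃ set_sub (edom f) (edom gs) `&` set_add (edom fs) (edom g)).
Proof.
move=> T fs gs.
have rf := subdifferential_rectangular f_proper.
have rg := subdifferential_rectangular g_proper.
have solve := douglas_rachford_solvable f_proper f_lsc f_convex g_proper g_lsc g_convex.
split.
  have -> : op_range (op_sub op_id T) = [set z | exists a b v,
      [/\ subdifferential f a (a - b - v), subdifferential g b v & z = a - b]].
    apply/seteqP; split=> z.
      move=> [_ _ [x -> [_ /douglas_rachfordP[a [b [v [fa gb -> ->]]]] <-]]].
      by exists a, b, v; split => //; rewrite addrCA addrK.
    move=> [a [b [v [fa gb ->]]]]; exists (a + (a - b - v)) => //.
    exists (a + (a - b - v)) => //; exists (a - v); last by rewrite addrCA addrK.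
    by apply/douglas_rachfordP; exists a, b, v.
  exact: rectangular_displacement_range.
(* with [b] and [v] exchanged, [T x] takes the form of a displacement *)
have -> : op_range T = [set z | exists a v b, [/\ subdifferential f a (a - v - b),
    op_inv (subdifferential g) v b & z = a - v]].
  apply/seteqP; split=> z.
    move=> [x _ /douglas_rachfordP[a [b [v [fa gb xE ->]]]]].
    by exists a, v, b; rewrite addrAC.
  move=> [a [v [b [fa gb ->]]]]; exists (a + (a - v - b)) => //.
  by apply/douglas_rachfordP; exists a, b, v; rewrite [a - b - v]addrAC.
apply: rectangular_displacement_range => //; first exact: rectangular_inv.
move=> x; have [a [b [v [fa gb ->]]]] := solve x.
by exists a, v, b; rewrite [a - v - b]addrAC.
Qed.
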